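(* If $G$ is a nonsolvable finite group, then $\mathrm{minmaxl}(G)\ge \mathrm{chiefl}(G)+2$.
   Context: For a finite group $G$, $\mathcal{L}(G)$ denotes the lattice of all subgroups of $G$ ordered by inclusion. A chain in $\mathcal{L}(G)$ is a subset totally ordered by inclusion; it is maximal if it is not properly contained in any other chain (so a maximal chain contains $1$ and $G$). The length of a chain is its number of elements minus one. $\mathrm{minmaxl}(G)$ is the minimum length of a maximal chain in $\mathcal{L}(G)$. $\mathrm{chiefl}(G)$ is the length of a chief series of $G$, i.e. of a chain $1=N_0<N_1<\dots<N_r=G$ of normal subgroups of $G$ that cannot be refined by inserting further normal subgroups of $G$ (its length is $r$, which is independent of the chief series). *)

(* Defs.v *)
From mathcomp Require Import all_boot all_fingroup all_solvable.

Set Implicit Arguments.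
Unset Strict Implicit.
Unset Printing Implicit Defensive.

Local Open Scope group_scope.

Section SubgroupLattice.

Variable gT : finGroupType.
Implicit Types (G H K : {group gT}) (C : {set {group gT}}).

Definition subgroup_chain G C :=
  (C \subset subgroups G) &&
  [forall H in C, forall K in C, (H \subset K) || (K \subset H)].

Definition max_subgroup_chain G C := maxset (subgroup_chain G) C.

Definition chain_length C : nat := #|C|.-1.

Definition max_chain_length G : pred nat :=
  fun n => [exists C, max_subgroup_chain G C && (chain_length C == n)].

Lemma max_chain_length_exists G : exists n, max_chain_length G n.
Proof.
have chain0: subgroup_chain G set0.
  by rewrite /subgroup_chain sub0set; apply/forall_inP=> H; rewrite inE.
have [C maxC _] := maxset_exists chain0.
by exists (chain_length C); apply/existsP; exists C; rewrite eqxx andbT.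
Qed.

Definition minmaxl G : nat := ex_minn (max_chain_length_exists G).

(* [G.-chief] relates V to U when U <| G and V is maximal among the proper    *)
(* subgroups of U normalised by G. The initial 1 of the series is not listed  *)
(* in s, so that size s is the number of steps.                               *)
Definition chief_series G (s : seq {group gT}) : bool :=
  (G.-chief).-series 1%G s && (last 1%G s == G).

Definition chiefl G : nat :=
  size (s2val (chief_series_exists (normal_refl G))).

(* By the Jordan-Holder theorem for the conjugation action of G, [chiefl] does *)
(* not depend on the series picked by [chief_series_exists].                   *)
Lemma chief_series_acomps G s :
  chief_series G s ->
  acomps ('J \ subsetT G) G (rev (belast 1%G s)).
Proof.
case/andP=> ch_s /eqP last_s; apply/andP; split.
  case: s ch_s last_s => [|H s] _ /=; first by move <-.
  by rewrite rev_cons last_rcons.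
set e := (X in path X); rewrite -[in path e _ _]last_s rev_path.
apply: sub_path ch_s => V U /=; rewrite /e /=.
case/andP=> /maxgroupP[/andP[prVU nVG] maxV] /andP[sUG nUG].
have actJ K : [acts G, on K | 'J \ subsetT G] = (G \subset 'N(K)).
  by rewrite acts_ract subxx /= astabsJ.
apply/maxgroupP; split=> [|K /and3P[nKU prUK aK] sVK].
  rewrite actJ nVG andbT; case/andP: prVU => sVU ->; rewrite andbT.
  by rewrite /normal sVU (subset_trans sUG nVG).
apply: maxV => //; rewrite properE (normal_sub nKU) prUK /=.
by rewrite -actJ.
Qed.

Lemma chieflE G s : chief_series G s -> size s = chiefl G.
Proof.
rewrite /chiefl; case: chief_series_exists => t /= ch_t last_t ch_s.
have {}ch_t: chief_series G t.
  by rewrite /chief_series ch_t last_t eqxx.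
have := StrongJordanHolderUniqueness (subsetT G)
  (chief_series_acomps ch_s) (chief_series_acomps ch_t).
by move/perm_size; rewrite !size_map !size_pairmap !size_rev !size_belast.
Qed.

End SubgroupLattice.

(* Main.v *)
Require Import Defs.
From mathcomp Require Import all_boot all_fingroup all_solvable.
From mathcomp Require Import ssralg finalg.

(* The length of normal series is compared with minmaxl G by induction along  *)
(* a maximal chain, passing from G to a maximal subgroup M. Intersecting a    *)
(* normal series of G with M can lose only one step: if N < K are the         *)
(* consecutive terms with N <= M and K not in M, then MK = G, so beyond K the *)
(* intersections with M stay distinct. Hence minmaxl G is at least the length *)
(* of the series, and an excess of 2 for M is inherited by G. If G is         *)
(* nonsolvable but M is solvable, then instead a step is gained: some normal  *)
(* subgroup of M lies strictly between N and M :&: K. Reducing to N = 1 and K *)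
(* minimal normal (hence nonsolvable), a coprime action argument gives        *)
(* M :&: K <> 1, and if M :&: K were minimal normal in M it would be a        *)
(* self-normalising abelian Sylow subgroup of K, so that K would not be       *)
(* perfect by Burnside's transfer theorem.                                    *)

Set Implicit Arguments.
Unset Strict Implicit.
Unset Printing Implicit Defensive.

Local Open Scope group_scope.

(** The induction on [#|G|] in [minmaxl_normal_series] treats any strictly increasing series of
    normal subgroups starting at 1. Passing to [M] costs at least one on the chain side
    ([minmaxl_maximal]) and at most one on the series side ([normal_series_cap]). The 2 appears
    where [G] is nonsolvable and [M] solvable: by [cap_max_normal_refine] the series then gains a
    term instead of losing one. *)

(** * Burnside's transfer theorem *)

(** Both [P] and [P :^ x] are Sylow in ['C_K[g ^ x]], hence conjugate there by some [y]; then
    [x * y] normalises [P], so it centralises [g]. *)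
Lemma abelian_Sylow_fusion
    (gT : finGroupType) (p : nat) (K P : {group gT}) (g x : gT) :
    p.-Sylow(K) P -> abelian P -> 'N_K(P) \subset 'C(P) ->
    x \in K -> g \in P -> g ^ x \in P ->
  g ^ x = g.
Proof.
move=> sylP abP cNP Kx Pg Pgx; have sPK := pHall_sub sylP.
have sylC (Q : {group gT}) :
    p.-Sylow(K) Q -> Q \subset 'C[g ^ x] -> p.-Sylow('C_K[g ^ x]) Q.
  move=> sylQ cQ; apply: (pHall_subl _ (subsetIl _ _) sylQ).
  by rewrite subsetI (pHall_sub sylQ).
have sylP1: p.-Sylow('C_K[g ^ x]) P.
  by apply: sylC; rewrite // sub_cent1 (subsetP abP).
have sylP2: p.-Sylow('C_K[g ^ x]) (P :^ x)%G.
  apply: sylC; rewrite ?pHallJ //= -conjg_set1 ?normJ ?cent1J conjSg.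
  by rewrite sub_cent1 (subsetP abP).
have [y /setIP[Ky cy] defP] := Sylow_trans sylP2 sylP1.
have Nxy : x * y \in 'N_K(P).
  by rewrite inE groupM //=; apply/normP; rewrite conjsgM -defP.
have /centP/(_ g Pg) cxy := subsetP cNP _ Nxy.
have <- : (g ^ x) ^ y = g ^ x by apply/conjg_fixP/commgP/commute_sym/cent1P.
by rewrite -conjgM; apply/conjg_fixP/commgP.
Qed.

Lemma Burnside_transfer (gT : finGroupType) (p : nat) (K P : {group gT}) :
  p.-Sylow(K) P -> 'N_K(P) \subset 'C(P) -> P :&: K^`(1) = 1.
Proof.
move=> sylP cNP; have sPK := pHall_sub sylP.
have abP: abelian P by apply: subset_trans cNP; rewrite subsetI sPK normG.
have abA: abelian (idm P @* P) by rewrite morphim_idm.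
pose V := transfer_morphism K abA.
have VK' : V @* K^`(1) = 1.
  by rewrite morphim_der //; apply/derG1P; apply: FinRing.zmod_abelian.
apply/trivgP/subsetP=> g /setIP[Pg K'g]; have Kg := subsetP sPK g Pg.
have Vg1 : V g = 1.
  by apply/set1P; rewrite -[[set 1]]VK' mem_morphim.
(* By fusion control the transfer of g into P is the power of g of exponent   *)
(* the index #|K : P|, which is prime to #[g].                                *)
have trX := transversalP (rcosets_cycle_partition sPK Kg).
have := transfer_cycle_expansion sPK abA Kg trX; rewrite [LHS]Vg1.
rewrite (eq_bigr (fun x => FiniteModule.fmod abA g *+ #|<[g]> : P :* x|)%R).
  rewrite GRing.sumrMnr (sum_index_rcosets_cycle sPK Kg trX).
  move/(congr1 val); rewrite [RHS]FiniteModule.fmvalZ.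
  rewrite FiniteModule.fmodK /= ?morphim_idm // => gn1.
  have /andP[_ coP] := pHall_Hall sylP.
  by rewrite inE -(expgK coP Pg) -gn1 expg1n.
move=> x /(subsetP (transversal_sub trX)) Kx.
set n := #|<[g]> : P :* x|; have Pgx : (g ^+ n) ^ x^-1 \in P.
  by rewrite conjgE invgK mulgA -mem_rcoset mulg_exp_card_rcosets.
have Kx' : x^-1 \in K by rewrite groupV.
have -> := abelian_Sylow_fusion sylP abP cNP Kx' (groupX n Pg) Pgx.
by rewrite [LHS]FiniteModule.fmodX //= morphim_idm.
Qed.

(** * Intersecting a solvable maximal subgroup with normal subgroups *)

Lemma max_mulg (gT : finGroupType) (G M L : {group gT}) :
    maximal M G -> L \subset G -> M \subset 'N(L) -> ~~ (L \subset M) ->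
  M * L = G.
Proof.
move=> /maxgroupP[ltMG maxM] sLG nLM nsLM.
rewrite -norm_joinEl //; apply/eqP.
rewrite eqEproper join_subG (proper_sub ltMG) sLG /=.
apply: contra nsLM => ltML.
by rewrite -(maxM _ ltML (joing_subl _ _)) joing_subr.
Qed.

Lemma nonsolvable_supplemented (gT : finGroupType) (G M K : {group gT}) :
    M * K = G -> K <| G -> solvable M -> ~~ solvable G -> ~~ solvable K.
Proof.
move=> defG nsKG solM; rewrite (series_sol nsKG) negb_and => /orP[//|].
by rewrite -{1}defG quotientMidr quotient_sol.
Qed.

Section NonsolvableMinnormal.

Variables (gT : finGroupType) (G M K : {group gT}).
Hypotheses (maxM : maximal M G) (solM : solvable M).
Hypotheses (minK : minnormal K G) (sKG : K \subset G).
Hypotheses (nsolG : ~~ solvable G) (nsKM : ~~ (K \subset M)).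

Let sMG : M \subset G. Proof. exact: proper_sub (maxgroupp maxM). Qed.
Let nKG : G \subset 'N(K). Proof. by case/mingroupP: minK => /andP[]. Qed.
Let nsKG : K <| G. Proof. exact/andP. Qed.
Let defG : M * K = G.
Proof. exact: max_mulg maxM sKG (subset_trans sMG nKG) nsKM. Qed.
Let nsolK : ~~ solvable K.
Proof. exact: nonsolvable_supplemented defG nsKG solM nsolG. Qed.

Lemma cap_max_minnormal_neq1 : M :&: K != 1.
Proof.
apply/eqP=> tiMK.
(* [K] has no proper nontrivial [M]-invariant subgroup: [M * L = G] and Dedekind's law give
   [K = (M :&: K) * L = L]. *)
have invK (L : {group gT}) :
    L \subset K -> M \subset 'N(L) -> L :!=: 1 -> L :=: K.
  move=> sLK nLM ntL; apply/eqP; rewrite eqEsubset sLK /=.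
  have [|nsLM] := boolP (L \subset M).
    by move=> sLM; case/eqP: ntL; apply/trivgP; rewrite -tiMK subsetI sLM.
  rewrite -(setIidPl sKG) -(max_mulg maxM (subset_trans sLK sKG) nLM nsLM).
  by rewrite -group_modr // setIC tiMK mul1g.
pose D := 'C_M(K)%G; have nsDM : D <| M.
  by rewrite /normal subsetIl normsI ?normG ?norms_cent // (subset_trans sMG).
have ntK : K :!=: 1 by apply: contraNneq nsolK => ->; apply: solvable1.
have neqDM : M / D != 1.
  (* If [M] centralised [K], every cyclic subgroup of [K] would be [M]-invariant, making [K]
     cyclic. *)
  rewrite -subG1 quotient_sub1 ?normal_norm // subsetI subxx /=.
  have [x Kx ntx] := trivgPn _ ntK; apply: contra nsolK => cMK.
  rewrite -(invK <[x]>%G) ?cycle_subG ?cycle_eq1 ?abelian_sol ?cycle_abelian //.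
  by rewrite cents_norm // (subset_trans cMK) // centS // cycle_subG.
have [Ab [_ nsAb ntA /is_abelemP[p p_pr /abelem_pgroup pA]]] :=
  solvable_norm_abelem (quotient_sol D solM) (normal_refl _) neqDM.
have [A defAb sDA nsAM] := inv_quotientN nsDM nsAb.
rewrite {Ab nsAb}defAb in ntA pA.
have [sAM nAM] := andP nsAM; have nDA := subset_trans sAM (normal_norm nsDM).
have [P sylP] := Sylow_exists p A; have sPA := pHall_sub sylP.
have defA : D * P = A.
  apply/eqP; rewrite eqEsubset mul_subG //=.
  rewrite -quotientSK //.
  have sylPD := quotient_pHall (subset_trans sPA nDA) sylP.
  by rewrite (sub_pHall sylPD pA) ?quotientS.
have nKA : A \subset 'N(K) by rewrite (subset_trans sAM) ?(subset_trans sMG).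
have nKP := subset_trans sPA nKA.
(* [D] centralises [K], so [P] and [A = D * P] have the same fixed points on [K]. As [A <| M], these
   form an [M]-invariant subgroup, thus 1 or [K]; the latter would put [A] inside [D]. *)
have cPK : 'C_K(P) = 'C_K(A).
  apply/eqP; rewrite eqEsubset andbC setIS ?centS //= subsetI subsetIl /=.
  rewrite centsC -defA mul_subG //; last by rewrite centsC subsetIr.
  by rewrite (subset_trans (subsetIr _ _)) // centS ?subsetIl.
have tiKP : 'C_K(P) = 1.
  apply/eqP; apply: contraR ntA => ntC.
  rewrite -subG1 quotient_sub1 // subsetI sAM centsC.
  rewrite -{1}(invK 'C_K(A)%G) /= -?cPK ?subsetIl // cPK ?subsetIr //.
  by rewrite normsI ?norms_cent // (subset_trans sMG).
have pP := pHall_pgroup sylP.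
(* Otherwise the number of fixed points of P on K would be divisible by p.    *)
have p'K : p^'.-group K.
  rewrite /pgroup p'natE //; apply/negP=> /eqnP pK.
  have actsPK : [acts P, on K | 'J] by rewrite astabsJ.
  have := pgroup_fix_mod pP actsPK.
  by rewrite afixJ tiKP cards1 pK modn_small // prime_gt1.
have coKP : coprime #|K| #|P| by rewrite coprime_sym (pnat_coprime pP).
have solP := pgroup_sol pP.
(* K is not a q-group, so it has no M-invariant Sylow q-subgroup; but the     *)
(* P-invariant one is unique because 'C_K(P) = 1.                             *)
set q := pdiv #|K|.
have [Q sylQ nQP] := sol_coprime_Sylow_exists q solP nKP coKP.
have sQK := pHall_sub sylQ.
have ntQ : Q :!=: 1.
  rewrite -rank_gt0 (rank_Sylow sylQ) p_rank_gt0 pi_pdiv cardG_gt1 //.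
suffices nQM : M \subset 'N(Q).
  by case/negP: nsolK; rewrite -(invK Q) // (pgroup_sol (pHall_pgroup sylQ)).
have nQA : A \subset 'N(Q).
  rewrite -defA mul_subG // cents_norm // centsC (subset_trans sQK) //.
  by rewrite centsC subsetIr.
apply/subsetP=> m Mm; apply/normP.
have := sol_coprime_Sylow_trans q solP nKP coKP; rewrite tiKP.
have nKm : m \in 'N(K) by rewrite (subsetP nKG) ?(subsetP sMG).
have QinS : Q \in [set P0 in 'Syl_q(K) | P \subset 'N(P0)].
  by rewrite !inE sylQ.
have QmS : (Q :^ m)%G \in [set P0 in 'Syl_q(K) | P \subset 'N(P0)].
  rewrite !inE /= -{1}(normP nKm) pHallJ2 sylQ.
  by rewrite normJ (subset_trans sPA) // -(normsP nAM m) ?conjSg.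
move=> trQ; have [_ /set1P-> /(congr1 val)] := atransP2 trQ QinS QmS.
by rewrite /= conjsg1.
Qed.

Lemma cap_max_minnormal_refine :
  exists2 X : {group gT}, X <| M & X :!=: 1 /\ X \proper M :&: K.
Proof.
have nBM : M \subset 'N(M :&: K) by rewrite normsI ?normG // (subset_trans sMG).
have [X minX sXB] := minnormal_exists cap_max_minnormal_neq1 nBM.
have sXM := subset_trans sXB (subsetIl _ _).
have [nXM ntX /is_abelemP[p _ /and3P[pX abX _]]] :=
  minnormal_solvable minX sXM solM.
exists X; first exact/andP.
split=> //; rewrite properEneq sXB andbT.
apply/eqP=> defX; have sXK : X \subset K by rewrite defX subsetIr.
have /mingroupP[_ minK'] := minK.
(* By minimality of [K], [X] is not normal in [G], so its normaliser is no larger than the maximal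
   subgroup [M]. *)
have nXG : 'N_G(X) = M.
  have /maxgroupP[_ maxM'] := maxM.
  apply: (maxM' 'N_G(X)%G); rewrite ?subsetI ?sMG // properEneq subsetIl andbT.
  apply: contra nsKM => /eqP defN; rewrite -(minK' X) // ntX -defN.
  exact: subsetIr.
have nXK : 'N_K(X) = X by rewrite {2}defX -nXG setIAC (setIidPr sKG).
have [P sylP sXP] := Sylow_superset sXK pX.
(* Normalisers grow in the [p]-group [P], but [X] is self-normalising in [K]. *)
have eqPX : P :=: X.
  apply: nilpotent_sub_norm (pgroup_nil (pHall_pgroup sylP)) sXP _.
  by rewrite -{2}nXK setSI // (pHall_sub sylP).
have := Burnside_transfer sylP; rewrite eqPX nXK => /(_ abX).
have [K'1 | ntK'] := eqVneq K^`(1) 1.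
  by case/negP: nsolK; rewrite abelian_sol //; apply/derG1P.
rewrite (minK' K^`(1)%G) ?der_sub ?ntK' ?(char_norm_trans (der_char 1 K)) //.
by rewrite (setIidPl sXK); apply/eqP.
Qed.

End NonsolvableMinnormal.

(** Taking [V] maximal among the [G]-normal subgroups of [M :&: K] above [N], and [U] minimal among
    those of [K] above [V] and outside [M], makes [U / V] minimal normal in [G / V]: a normal
    subgroup in between equals [V] if inside [M], and [U] otherwise. *)
Lemma cap_max_normal_refine (gT : finGroupType) (G M N K : {group gT}) :
    maximal M G -> solvable M -> ~~ solvable G ->
    N <| G -> K <| G -> N \subset M -> N \subset K -> ~~ (K \subset M) ->
  exists2 X : {group gT}, X <| M & N \proper X /\ X \proper M :&: K.
Proof.
move=> maxM solM nsolG nsNG nsKG sNM sNK nsKM.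
have sMG := proper_sub (maxgroupp maxM).
pose below (L : {group gT}) := (L \subset M :&: K) && (L <| G).
have [|V /maxgroupP[/andP[]]] := @maxgroup_exists _ below N.
  by rewrite /below subsetI sNM sNK.
rewrite subsetI => /andP[sVM sVK] nsVG maxV sNV.
pose above (L : {group gT}) := [&& V \subset L, L <| G & ~~ (L \subset M)].
have [|U /mingroupP[/and3P[sVU nsUG nsUM] minU] sUK] :=
  @mingroup_exists _ above K.
  by rewrite /above sVK nsKG.
have nVG := normal_norm nsVG; have nsVM := normalS sVM sMG nsVG.
have nVU := subset_trans (normal_sub nsUG) nVG.
have minUV : minnormal (U / V) (G / V).
  apply/mingroupP; split.
    rewrite quotient_norms ?normal_norm // andbT -subG1 quotient_sub1 //.
    by apply: contra nsUM => /subset_trans->.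
  move=> Lb /andP[ntL nLG] sLU.
  have nsLG : Lb <| G / V.
    by rewrite /normal nLG (subset_trans sLU) // quotientS ?normal_sub.
  have [L defL sVL nsL] := inv_quotientN nsVG nsLG.
  have sLU' : L \subset U.
    by rewrite -(quotientSGK _ sVU) -?defL // (subset_trans (normal_sub nsL)).
  rewrite defL (minU L) //; rewrite /above sVL nsL /=.
  apply: contra ntL => sLM; rewrite defL (maxV L) ?trivg_quotient //.
  by rewrite /below subsetI sLM (subset_trans sLU').
have maxMV : maximal (M / V) (G / V) by rewrite quotient_maximal.
have nsolGV : ~~ solvable (G / V).
  by apply: contra nsolG => solGV; rewrite (series_sol nsVG) (solvableS sVM).
have nsUMV : ~~ (U / V \subset M / V) by rewrite quotientSGK.
have [Xb nsXM [ntX ltX]] := cap_max_minnormal_refine maxMV (quotient_sol V solM)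
  minUV (quotientS V (normal_sub nsUG)) nsolGV nsUMV.
have [X defX sVX nsX] := inv_quotientN nsVM nsXM.
exists X => //; rewrite defX in ntX ltX.
have nVX : X \subset 'N(V).
  by rewrite (subset_trans (normal_sub nsX)) ?normal_norm.
split.
  apply: sub_proper_trans sNV _; rewrite properE sVX /=.
  by rewrite -quotient_sub1 // subG1.
suffices ltXU : X \proper M :&: U by apply: proper_sub_trans ltXU (setIS _ sUK).
rewrite -quotientIG // in ltX; case/andP: ltX => sX nsX'.
rewrite properE -(quotientSGK nVX) ?sX /=; last by rewrite subsetI sVM.
by apply: contra nsX' => sUX; apply: quotientS.
Qed.

(** Steps may be refinable, unlike chief steps, since intersecting a chief series of [G] with [M]
    need not give a chief series of [M]. *)
Definition normal_step (gT : finGroupType) (G : {group gT}) : rel {group gT} :=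
  fun V U => (V \proper U) && (U <| G).

Section NormalSeries.

Variable gT : finGroupType.
Implicit Types (G M N K : {group gT}) (C : {set {group gT}}).
Implicit Types (s : seq {group gT}).

Lemma last_normal_series G s :
  path (normal_step G) 1%G s -> last 1%G s <| G.
Proof.
case/lastP: s => [_|s U]; first exact: normal1.
by rewrite rcons_path last_rcons => /andP[_ /andP[]].
Qed.

Lemma normal_series_sub G M N s :
    M \subset G -> N \subset M -> all (fun L : {group gT} => L \subset M) s ->
  path (normal_step G) N s -> path (normal_step M) N s.
Proof.
move=> sMG sNM sM.
apply: (sub_in_path (P := [pred L : {group gT} | L \subset M])).
  move=> V U _ sUM /andP[ltVU nsUG].
  by rewrite /normal_step ltVU (normalS sUM sMG).
by rewrite /= sNM.
Qed.

(** By Dedekind's law each [U] above [K] is [(M :&: U) * K], so proper inclusions above [K] survive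
    the intersection. *)
Lemma normal_series_cap G M K s :
    M \subset G -> M * K = G -> path (normal_step G) K s ->
  path (normal_step M) (M :&: K)%G [seq (M :&: L)%G | L : {group gT} <- s].
Proof.
move=> sMG; elim: s K => //= U s IHs K defG /andP[/andP[ltKU nsUG] pathU].
have sKU := proper_sub ltKU.
apply/andP; split; last first.
  apply: IHs pathU; apply/eqP.
  rewrite eqEsubset mul_subG ?(normal_sub nsUG) //=.
  by rewrite -{1}defG mulgS.
rewrite /normal_step (normalGI sMG nsUG) andbT properE setIS //=.
apply: contra (proper_subn ltKU) => sUK.
rewrite -(setIidPl (normal_sub nsUG)) -defG -group_modr // setIC mul_subG //.
exact: subset_trans sUK (subsetIr _ _).
Qed.

Lemma normal_series_widen G N K s :
  N \subset K -> path (normal_step G) K s -> path (normal_step G) N s.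
Proof.
move=> sNK; case: s => //= U s /andP[/andP[ltKU nsUG] ->].
by rewrite /normal_step (sub_proper_trans sNK ltKU) nsUG.
Qed.

(** * Maximal chains of subgroups *)

Lemma max_subgroup_chain_mem G C (L : {group gT}) :
    max_subgroup_chain G C -> L \subset G ->
    {in C, forall H : {group gT}, (H \subset L) || (L \subset H)} ->
  L \in C.
Proof.
move=> /maxsetP[/andP[sCG chC] maxC] sLG cmpL.
suffices chLC : subgroup_chain G (L |: C).
  by rewrite -(maxC _ chLC (subsetUr _ _)) setU11.
apply/andP; split.
  by apply/subsetP=> H /setU1P[-> | /(subsetP sCG)//]; rewrite inE.
apply/forall_inP=> H HLC; apply/forall_inP=> J.
case/setU1P: HLC => [->|CH] /setU1P[->|CJ]; rewrite ?subxx //.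
- by rewrite orbC cmpL.
- exact: cmpL.
by move/forall_inP/(_ _ CH)/forall_inP: chC; apply.
Qed.

(** Removing [G] from a shortest maximal chain leaves a maximal chain of its largest remaining
    member [M]. *)
Lemma minmaxl_maximal G :
  G :!=: 1 -> exists2 M : {group gT}, maximal M G & minmaxl M < minmaxl G.
Proof.
move=> ntG; rewrite {2}/minmaxl.
case: ex_minnP => _ /existsP[C /andP[maxC /eqP<-]] _.
have /maxsetP[/andP[sCG chC] maxC'] := maxC.
have sCG' (H : {group gT}) : H \in C -> H \subset G.
  by move/(subsetP sCG); rewrite inE.
have cmpC (H J : {group gT}) :
    H \in C -> J \in C -> (H \subset J) || (J \subset H).
  by move=> CH CJ; move/forall_inP/(_ _ CH)/forall_inP: chC; apply.
have CG : G \in C.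
  by apply: max_subgroup_chain_mem maxC _ _ => // H /sCG'->.
have C1 : 1%G \in C :\ G.
  rewrite !inE eq_sym -val_eqE ntG; apply: (max_subgroup_chain_mem maxC).
    exact: sub1G.
  by move=> H _; rewrite sub1G orbT.
have [M C'M maxM] := arg_maxnP (fun M : {group gT} => #|M|) C1.
have [neqMG CM] := setD1P C'M.
have subM (H : {group gT}) : H \in C :\ G -> H \subset M.
  move=> C'H; have /setD1P[_ CH] := C'H; have [//|sMH] := orP (cmpC _ _ CH CM).
  have leHM := maxM H C'H.
  suffices /eqP-> : H == M :> {set gT} by [].
  by rewrite eq_sym eqEcard sMH.
have ltMG : M \proper G by rewrite properEneq val_eqE neqMG sCG'.
have maxMG : maximal M G.
  apply/maxgroupP; split=> // L ltLG sML; apply/eqP.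
  rewrite eqEsubset sML andbT subM // !inE -val_eqE.
  have [sLG neqLG] := (proper_sub ltLG, proper_neq ltLG).
  rewrite neqLG; apply: (max_subgroup_chain_mem maxC sLG) => H CH.
  have [->|neqHG] := eqVneq H G; first by rewrite sLG orbT.
  by rewrite (subset_trans _ sML) ?subM // !inE neqHG.
exists M => //; rewrite /minmaxl.
case: ex_minnP => k _ /(_ (chain_length (C :\ G))) lek.
apply: leq_ltn_trans (lek _) _; last first.
  rewrite /chain_length (cardsD1 G C) CG add1n /=.
  by rewrite prednK // card_gt0; apply/set0Pn; exists 1%G.
apply/existsP; exists (C :\ G); rewrite eqxx andbT.
apply/maxsetP; split.
  apply/andP; split; first by apply/subsetP=> H C'H; rewrite inE subM.
  apply/forall_inP=> H /setD1P[_ CH]; apply/forall_inP=> J /setD1P[_ CJ].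
  exact: cmpC.
move=> B /andP[sBM chB] sCB; have notBG : G \notin B.
  apply/negP=> /(subsetP sBM); rewrite inE => sGM.
  by case/negP: (proper_subn ltMG).
have sBG (H : {group gT}) : H \in B -> H \subset G.
  by move/(subsetP sBM); rewrite inE => /subset_trans-> //; apply: proper_sub.
(* Adding [G] to a chain [B] of [M] gives a chain of [G] containing [C], hence equal to [C]. *)
rewrite -(maxC' (G |: B)) ?setU1K //; last first.
  by rewrite -(setD1K CG) setUS.
apply/andP; split.
  by apply/subsetP=> H /setU1P[->|/sBG]; rewrite inE.
apply/forall_inP=> H /setU1P[->|BH];
  apply/forall_inP=> J /setU1P[->|BJ]; rewrite ?subxx //.
- by rewrite sBG // orbT.
- by rewrite sBG.
by move/forall_inP/(_ _ BH)/forall_inP: chB; apply.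
Qed.

(** * The induction along a maximal chain *)

Lemma minmaxl_normal_series G s :
    path (normal_step G) 1%G s ->
  size s + (~~ solvable G).*2 <= minmaxl G.
Proof.
have [n] := ubnP #|G|; elim: n G s => // n IHn G s /ltnSE-leGn pathG.
have [G1 | ntG] := eqVneq (G :> {set gT}) 1.
  rewrite G1 solvable1 addn0; case: s pathG => //= U s /andP[/andP[]].
  by rewrite G1 => ltU /normal_sub sU; case/negP: (proper_subn ltU).
have [M maxM ltMG] := minmaxl_maximal ntG.
have pMG := maxgroupp maxM; have sMG := proper_sub pMG.
have {n IHn leGn} IHM t : path (normal_step M) 1%G t ->
    size t + (~~ solvable M).*2 < minmaxl G.
  move=> patht; apply: leq_ltn_trans ltMG; apply: IHn patht.
  exact: leq_trans (proper_card pMG) leGn.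
have sMs t : ~~ has (fun L : {group gT} => ~~ (L \subset M)) t ->
    all (fun L : {group gT} => L \subset M) t.
  by rewrite -all_predC; apply: sub_all => L /=; rewrite negbK.
have lastM t : all (fun L : {group gT} => L \subset M) t ->
    last 1%G t \subset M.
  by case/lastP: t => [|t U]; rewrite ?sub1G // all_rcons last_rcons => /andP[].
have [hasK|/sMs{sMs} sM] :=
  boolP (has (fun L : {group gT} => ~~ (L \subset M)) s); last first.
  have pathM := normal_series_sub sMG (sub1G M) sM pathG.
  have [solG | nsolG] := boolP (solvable G).
    by rewrite addn0 (leq_trans _ (IHM _ pathM)) // leqW ?leq_addr.
  have [solM | nsolM] := boolP (solvable M); last first.
    by apply: ltnW; have:= IHM _ pathM; rewrite nsolM.
  (* With the whole series inside [M], [G] plays the role of [K], and [X] and [M] extend the series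
     by two. *)
  have [X nsXM [ltX ltXM]] := cap_max_normal_refine maxM solM nsolG
    (last_normal_series pathG) (normal_refl G) (lastM _ sM)
    (normal_sub (last_normal_series pathG)) (proper_subn pMG).
  have := IHM (s ++ [:: X; M]); rewrite cat_path pathM /= /normal_step ltX nsXM.
  rewrite (setIidPl sMG) in ltXM; rewrite ltXM normal_refl => /(_ isT).
  by rewrite size_cat solM addn0 => /ltnW.
case: (split_find hasK) pathG => K s1 s2 nsKM /sMs{sMs} sM.
rewrite cat_path rcons_path last_rcons => /andP[/andP[path1 stepK] path2].
have /andP[ltNK nsKG] := stepK; have sKG := normal_sub nsKG.
have defG : M * K = G.
  by apply: max_mulg; rewrite ?(subset_trans sMG) ?normal_norm.
have pathM1 := normal_series_sub sMG (sub1G M) sM path1.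
have pathM2 := normal_series_cap sMG defG path2.
have sNM := lastM _ sM; have sNK := proper_sub ltNK.
rewrite size_cat size_rcons.
(* Only [K], the first term outside [M], is dropped; the strict inequality in [IHM] makes up for
   it. *)
have pathM :
    path (normal_step M) 1%G (s1 ++ [seq (M :&: L)%G | L : {group gT} <- s2]).
  by rewrite cat_path pathM1 (normal_series_widen _ pathM2) // subsetI sNM.
have := IHM _ pathM; rewrite size_cat size_map => IH.
have [solG | nsolG] := boolP (solvable G).
  by rewrite addn0 (leq_trans _ IH) // addSn ltnS leq_addr.
have [solM | nsolM] := boolP (solvable M); last first.
  by move: IH; rewrite nsolM.
(* Replacing [K] by both [X] and [M :&: K] gives [size s + 1] terms; the strict inequality in [IHM]
   supplies the other unit of the 2. *)
have [X nsXM [ltX ltXM]] := cap_max_normal_refine maxM solM nsolG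
  (last_normal_series path1) nsKG sNM sNK nsKM.
have := IHM (s1 ++ X :: (M :&: K)%G
                     :: [seq (M :&: L)%G | L : {group gT} <- s2]).
rewrite cat_path pathM1 /= pathM2 /normal_step ltX nsXM ltXM.
rewrite (normalGI sMG nsKG) => /(_ isT).
by rewrite size_cat /= size_map solM addn0 !addnS addn0 !addSn.
Qed.

End NormalSeries.

Theorem theorem1p4 (gT : finGroupType) (G : {group gT}) :
  ~~ solvable G -> chiefl G + 2 <= minmaxl G.
Proof.
move=> nsolG; rewrite /chiefl; case: chief_series_exists => s chs _ /=.
have := @minmaxl_normal_series gT G s; rewrite nsolG; apply.
apply: sub_path chs => V U /andP[/maxgroupP[/andP[ltVU _] _] nsUG].
by rewrite /normal_step ltVU.
Qed.
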